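(* For all integers $n,m,k\geq 0$, $$\sum_{j=0}^{m}s(m,j)A_{n+k+j,k+j}=\sum_{i=0}^{k}\sum_{r=0}^{n}\binom{k}{i}\binom{n}{r}m^{n+k-i-r}A_{r+i,i},$$ $$\sum_{j=0}^{m}s(m,j)A_{n+k+j,k+j}=\sum_{i=0}^{k}\sum_{r=0}^{n}\binom{k}{i}\binom{n}{r}m^{k-i}(m-1)^{n-r}B_{r+i},$$ $$\sum_{j=0}^{m}s(m,j)A_{n+k+j+1,n+1}=\sum_{i=0}^{k}\sum_{r=0}^{n}\binom{k}{i}\binom{n}{r}m^{k-i}(m+1)^{n-r}B_{r+i}.$$
   Context: $s(m,j)$ are the (signed) Stirling numbers of the first kind, defined by $x(x-1)\cdots(x-m+1)=\sum_{j=0}^{m}s(m,j)x^j$. A partition of a finite set is a collection of nonempty, pairwise disjoint subsets (blocks) whose union is the set; a singleton of a partition is a block with exactly one element. $B_n$ denotes the $n$-th Bell number ($B_0=1$). For integers $0\leq k\leq n$, $A_{n,k}$ denotes the number of partitions of $\{1,2,\dots,n+1\}$ whose largest singleton is $k+1$ (i.e. $\{k+1\}$ is a block and no $j>k+1$ forms a singleton block). The convention $0^0=1$ is used. *)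

(* Defs.v *)
From HB Require Import structures.
From mathcomp Require Import all_boot all_order all_algebra.
Set Implicit Arguments.
Unset Strict Implicit.
Unset Printing Implicit Defensive.
Import GRing.Theory.
Local Open Scope ring_scope.

Definition stirling1 (m j : nat) : int :=
  (\prod_(i < m) ('X - (i%:Z)%:P) : {poly int})`_j.

Definition bell (n : nat) : nat :=
  #|[set P : {set {set 'I_n}} | partition P [set: 'I_n]]|.

Definition largest_singleton (N : nat) (P : {set {set 'I_N}}) (i : 'I_N) : bool :=
  ([set i] \in P) && [forall j : 'I_N, (i < j)%N ==> ([set j] \notin P)].

(* The set {1, ..., n+1} is represented by 'I_n.+1 through x |-> x - 1, so the
   element k+1 is the ordinal of value k. The value is 0 when k > n. *)
Definition A (n k : nat) : nat :=
  #|[set P : {set {set 'I_n.+1}} | partition P [set: 'I_n.+1] &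
      [exists i : 'I_n.+1, (val i == k) && largest_singleton P i]]|.

(* Main.v *)
(** The argument is umbral. Let [L] be the linear functional on integer
    polynomials with [L (X^n)] the [n]-th Bell number. The Bell recurrence says
    [L (X * p) = L (p (X + 1))], hence [L ((X)_m * p) = L (p (X + m))] for the
    falling factorial [(X)_m]. Inclusion-exclusion on the elements that must not
    be singletons gives [A_(n, k) = L (X^k (X - 1)^(n - k))]. The left-hand
    sides are therefore values of [L] at multiples of a falling factorial,
    namely [(X)_m X^k (X - 1)^n] and
    [X (X - 1)_m X^n (X - 1)^k = (X)_(m + 1) X^n (X - 1)^k], and the identities
    are binomial expansions of the shifted polynomials. *)

Require Import Defs.
From HB Require Import structures.
From mathcomp Require Import all_boot all_order all_algebra.
From mathcomp Require Import ring zify.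
Set Implicit Arguments.
Unset Strict Implicit.
Unset Printing Implicit Defensive.
Import GRing.Theory.
Local Open Scope ring_scope.

Lemma card_ord_lt (N k : nat) : (k <= N)%N -> #|[set j : 'I_N | (j < k)%N]| = k.
Proof.
move=> lekN; rewrite -sum1dep_card -(big_ord_widen N (fun=> 1%N)) //.
by rewrite sum1_card card_ord.
Qed.

Lemma sum_powerset_card (T : finType) (D : {set T}) (F : nat -> nat) :
  (\sum_(X in powerset D) F #|X| = \sum_(i < #|D|.+1) 'C(#|D|, i) * F i)%N.
Proof.
rewrite (partition_big (fun X : {set T} => inord #|X| : 'I_#|D|.+1) xpredT) //=.
apply: eq_bigr => i _; rewrite -cards_draws -sum_nat_const.
apply: eq_big => X; rewrite !inE.
  by apply: andb_id2l => /subset_leq_card leXD; rewrite -val_eqE /= inordK.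
by case/andP=> /subset_leq_card leXD /eqP <-; rewrite inordK.
Qed.

Lemma scalar_mul_exprDn (R : comNzRingType) (S : comAlgType R) (f : {scalar S})
    (x y : S) (c d : R) (k n : nat) :
  f ((x + c%:A) ^+ k * (y + d%:A) ^+ n) =
  \sum_(0 <= i < k.+1) \sum_(0 <= r < n.+1)
    'C(k, i)%:R * 'C(n, r)%:R * c ^+ (k - i) * d ^+ (n - r)
      * f (x ^+ i * y ^+ r).
Proof.
rewrite addrC [y + _]addrC !exprDn mulr_suml linear_sum big_mkord /=.
apply: eq_bigr => i _; rewrite mulr_sumr linear_sum big_mkord /=.
apply: eq_bigr => r _; rewrite -linearZ /=; congr (f _).
rewrite !exprZn !expr1n -!scaler_nat -!scalerAl !mul1r -!scalerAr !scalerA.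
by congr (_ *: _); ring.
Qed.

Section Partitions.
Variable T : finType.
Implicit Types (D U X : {set T}) (P : {set {set T}}).

Definition partitions D : {set {set {set T}}} := [set P | partition P D].

Lemma card_partitions_block D X (Q : pred {set {set T}}) :
    X \subset D -> X != set0 ->
  #|[set P in partitions D | (X \in P) && Q P]| =
  #|[set P in partitions (D :\: X) | Q (X |: P)]|.
Proof.
move=> sXD X0.
have disXD : [disjoint X & D :\: X].
  by rewrite disjoint_sym; have /subsetDP[] := subxx (D :\: X).
have XnP P : partition P (D :\: X) -> X \notin P.
  move=> partP; apply: contraNN X0 => /(partitionS partP)/subsetDP[_].
  by rewrite -setI_eq0 setIid.
rewrite -[RHS](@card_in_imset _ _ (fun P => X |: P)); last first.
  move=> P1 P2; rewrite !inE => /andP[/XnP nP1 _] /andP[/XnP nP2 _] eqP12.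
  by rewrite -(setU1K nP1) eqP12 setU1K.
apply: eq_card => P; apply/idP/imsetP => [|[P' + ->]]; rewrite !inE.
  case/and3P=> partP XP QP; exists (P :\ X); last by rewrite setD1K.
  by rewrite !inE setD1K // partitionD1.
case/andP=> partP ->; rewrite eqxx andbT.
have := partitionU1 partP X0 disXD.
by rewrite setDE setUIr setUCr setIT (setUidPr sXD) => ->.
Qed.

Lemma pblock_eq_mem P D X x : partition P D -> x \in D -> x \in X ->
  (pblock P x == X) = (X \in P).
Proof.
move=> partP xD xX; apply/eqP/idP => [<-|XP].
  by rewrite pblock_mem // (cover_partition partP).
by rewrite (def_pblock (partition_trivIset partP) XP).
Qed.

Lemma card_partitions_rec (e : T) D : e \in D ->
  #|partitions D| = (\sum_(X in powerset (D :\ e)) #|partitions X|)%N.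
Proof.
move=> eD; have setDK X : X \subset D -> D :\: (D :\: X) = X.
  by move=> sXD; rewrite setDDr setDv set0U (setIidPr sXD).
pose block_of_e X := (e \in X) && (X \subset D).
rewrite -sum1_card (partition_big (pblock^~ e) block_of_e) /=; last first.
  move=> P; rewrite inE => partP.
  have eP : e \in cover P by rewrite (cover_partition partP).
  by rewrite /block_of_e mem_pblock eP (partitionS partP) // pblock_mem.
rewrite [RHS](reindex_onto (setD D) (setD D)) /=; last first.
  by move=> X; rewrite inE subsetD1 => /andP[/setDK].
apply: eq_big => X.
  rewrite inE subsetD1 subsetDl !inE eD andbT negbK; congr andb.
  by rewrite setDDr setDv set0U (sameP setIidPr eqP).
case/andP=> eX sXD; have X0 : X != set0 by apply/set0Pn; exists e.
transitivity #|[set P in partitions D | (X \in P) && predT P]|.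
  rewrite sum1dep_card; apply: eq_card => P; rewrite !inE andbT.
  by apply: andb_id2l => partP; apply: (pblock_eq_mem partP).
by rewrite card_partitions_block //; apply: eq_card => P; rewrite !inE andbT.
Qed.

Definition no_singleton_in U P := [forall u in U, [set u] \notin P].

Lemma no_singleton_in0 P : no_singleton_in set0 P.
Proof. by apply/forall_inP => u; rewrite inE. Qed.

Lemma no_singleton_in_setU1 (e : T) U P :
  no_singleton_in (e |: U) P = ([set e] \notin P) && no_singleton_in U P.
Proof.
apply/forall_inP/andP => [nP | [eP /forall_inP nP] u /setU1P[->//|/nP//]].
split; first by apply: nP; rewrite setU11.
by apply/forall_inP => u uU; apply: nP; rewrite setU1r.
Qed.

Definition partitions_no_singleton D U : {set {set {set T}}} :=
  [set P in partitions D | no_singleton_in U P].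

Lemma partitions_no_singleton0 D :
  partitions_no_singleton D set0 = partitions D.
Proof. by apply/setP => P; rewrite inE no_singleton_in0 andbT. Qed.

Lemma card_partitions_no_singleton_block (e : T) D U : e \in D -> e \notin U ->
  #|[set P in partitions_no_singleton D U | [set e] \in P]| =
  #|partitions_no_singleton (D :\ e) U|.
Proof.
move=> eD eU.
pose has_block_e P := ([set e] \in P) && no_singleton_in U P.
transitivity #|[set P in partitions D | has_block_e P]|.
  by apply: eq_card => P; rewrite !inE andbAC -andbA.
rewrite card_partitions_block ?sub1set -?card_gt0 ?cards1 //.
apply: eq_card => P; rewrite !inE; congr andb; apply: eq_forallb_in => u uU.
have ue : u != e by apply: contraNneq eU => <-.
by rewrite !inE (inj_eq set1_inj) (negPf ue).
Qed.

Lemma card_partitions_no_singleton_rec (e : T) D U : e \in D -> e \notin U ->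
  #|partitions_no_singleton D U| =
  (#|partitions_no_singleton (D :\ e) U| +
   #|partitions_no_singleton D (e |: U)|)%N.
Proof.
move=> eD eU; rewrite -card_partitions_no_singleton_block //.
rewrite -(cardsID [set P : {set {set T}} | [set e] \in P]); congr addn.
  by apply: eq_card => P; rewrite !inE.
by apply: eq_card => P; rewrite !inE no_singleton_in_setU1 andbCA.
Qed.

End Partitions.

Lemma card_partitions_imset (T T' : finType) (f : T -> T') (D : {set T}) :
  injective f -> #|partitions (f @: D)| = #|partitions D|.
Proof.
move=> f_inj.
pose image (A : {set T}) := f @: A; pose preimage (B : {set T'}) := f @^-1: B.
have partE (P : {set {set T}}) (D' : {set T}) :
    partition (image @: P) (f @: D') = partition P D'.
  exact: imset_partition.
rewrite -(card_imset _ (imset_inj (imset_inj f_inj))); apply: eq_card => Q.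
apply/idP/imsetP => [|[P + ->]]; last by rewrite !inE partE.
rewrite inE => partQ; have preimageK : {in Q, cancel preimage image}.
  move=> B /(partitionS partQ)/subsetP sB; apply/setP => y.
  apply/imsetP/idP => [[x + ->]|yB]; first by rewrite inE.
  by have /imsetP[x _ eq_y] := sB y yB; exists x; rewrite // inE -eq_y.
have QE : Q = image @: (preimage @: Q).
  by rewrite -imset_comp -[LHS]imset_id; apply: eq_in_imset => B /preimageK.
by exists (preimage @: Q); rewrite // inE -partE -QE.
Qed.

Lemma card_partitions (T : finType) (D : {set T}) : #|partitions D| = bell #|D|.
Proof.
have enumD : enum_val @: [set: 'I_#|D|] = D.
  apply/setP => x; apply/imsetP/idP => [[i _ ->]|xD]; first exact: enum_valP.
  by exists (enum_rank_in xD x); rewrite ?enum_rankK_in.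
by rewrite -[in LHS]enumD; apply/card_partitions_imset/enum_val_inj.
Qed.

Lemma bellS n : bell n.+1 = (\sum_(i < n.+1) 'C(n, i) * bell i)%N.
Proof.
have -> : bell n.+1 = #|partitions [set: 'I_n.+1]| by [].
rewrite (card_partitions_rec (in_setT ord0)).
have cD : #|[set: 'I_n.+1] :\ ord0| = n by rewrite setTD cardsC1 card_ord.
rewrite -[in RHS]cD -sum_powerset_card.
by apply: eq_bigr => X _; apply: card_partitions.
Qed.

Section UmbralEvaluation.
Variables (R : nzRingType) (u : nat -> R).

Definition umbral_eval (p : {poly R}) : R := \sum_(i < size p) p`_i * u i.

Lemma umbral_eval_widen N (p : {poly R}) : (size p <= N)%N ->
  umbral_eval p = \sum_(i < N) p`_i * u i.
Proof.
move=> lepN; rewrite /umbral_eval (big_ord_widen _ (fun i => p`_i * u i) lepN).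
rewrite big_mkcond; apply: eq_bigr => i _.
by case: ltnP => // /(nth_default 0) ->; rewrite mul0r.
Qed.

Lemma umbral_eval_is_scalar : scalar umbral_eval.
Proof.
move=> a p q; pose N := maxn (size (a *: p + q)) (maxn (size p) (size q)).
rewrite !(@umbral_eval_widen N) ?leq_max ?leqnn ?orbT //.
rewrite mulr_sumr -big_split /=; apply: eq_bigr => i _.
by rewrite coefD coefZ mulrDl mulrA.
Qed.

HB.instance Definition _ :=
  GRing.isLinear.Build R {poly R} R *%R umbral_eval umbral_eval_is_scalar.

Lemma umbral_evalXn n : umbral_eval 'X^n = u n.
Proof.
rewrite (@umbral_eval_widen n.+1) ?size_polyXn // big_ord_recr /=.
rewrite big1 => [|i _].
  by rewrite coefXn eqxx mul1r add0r.
by rewrite coefXn ltn_eqF ?mul0r.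
Qed.

End UmbralEvaluation.

Local Notation bell_eval := (umbral_eval (fun i => (bell i)%:Z)).

Lemma bell_eval_mulX p : bell_eval ('X * p) = bell_eval (p \Po ('X + 1)).
Proof.
rewrite -[p]coefK poly_def mulr_sumr !linear_sum /=; apply: eq_bigr => i _.
rewrite -scalerAr comp_polyZ !linearZ /=; congr (_ * _).
rewrite -exprS umbral_evalXn bellS comp_Xn_poly addrC exprDn linear_sum /=.
rewrite (big_morph _ PoszD (erefl _)); apply: eq_bigr => j _.
by rewrite expr1n mul1r raddfMn /= umbral_evalXn PoszM -mulr_natl natz.
Qed.

Definition falling (m : nat) : {poly int} := \prod_(i < m) ('X - (i%:Z)%:P).

Lemma fallingS m : falling m.+1 = 'X * (falling m \Po ('X - 1)).
Proof.
rewrite /falling big_ord_recl subr0 rmorph_prod /=; congr (_ * _).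
apply: eq_bigr => i _.
by rewrite comp_polyB comp_polyX comp_polyC PoszD polyCD opprD addrA.
Qed.

Lemma size_falling m : size (falling m) = m.+1.
Proof.
rewrite /falling -(big_mkord xpredT (fun i => 'X - (i%:Z)%:P)).
by rewrite size_prod_XsubC size_iota subn0.
Qed.

Lemma falling_comp_polyE m (q : {poly int}) :
  falling m \Po q = \sum_(0 <= j < m.+1) stirling1 m j *: q ^+ j.
Proof. by rewrite comp_polyE size_falling big_mkord. Qed.

Lemma scalar_falling_comp_poly (f : {scalar {poly int}}) m (q g : {poly int}) :
  f ((falling m \Po q) * g) =
  \sum_(0 <= j < m.+1) stirling1 m j * f (q ^+ j * g).
Proof.
rewrite falling_comp_polyE mulr_suml linear_sum; apply: eq_bigr => j _.
by rewrite -scalerAl linearZ.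
Qed.

Lemma bell_eval_falling m p :
  bell_eval (falling m * p) = bell_eval (p \Po ('X + (m%:Z)%:P)).
Proof.
elim: m p => [|m IHm] p.
  by rewrite /falling big_ord0 mul1r addr0 comp_polyXr.
rewrite fallingS -mulrA bell_eval_mulX comp_polyM -comp_polyA comp_polyB.
rewrite comp_polyX comp_polyC addrK comp_polyXr IHm -comp_polyA comp_polyD.
by rewrite comp_polyX rmorph1 intS polyCD [1%:P + _]addrC addrA.
Qed.

Lemma card_partitions_no_singleton (T : finType) (D U : {set T}) :
    [disjoint D & U] ->
  #|partitions_no_singleton (D :|: U) U|%:Z =
  bell_eval ('X^#|D| * ('X - 1) ^+ #|U|).
Proof.
have [n] := ubnP #|U|; elim: n D U => // n IHn D U leUn disDU.
have [->|/set0Pn[e eU]] := eqVneq U set0.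
  rewrite setU0 cards0 mulr1 umbral_evalXn partitions_no_singleton0.
  by rewrite card_partitions.
have eD : e \notin D by rewrite (disjointFl disDU).
have ltUe : (#|U :\ e| < n)%N by rewrite (cardsD1 e) eU in leUn.
have disDUe : [disjoint D & U :\ e] by apply: disjointWr disDU; apply: subsetDl.
have dis_eDUe : [disjoint e |: D & U :\ e].
  by rewrite disjoints_subset subUset sub1set !inE eqxx -disjoints_subset.
have eDU : e \in D :|: U by rewrite inE eU orbT.
have DU_rem : (D :|: U) :\ e = D :|: (U :\ e).
  rewrite setDUl; congr setU; apply/setDidPl.
  by rewrite disjoint_sym disjoints1.
have DU_move : D :|: U = (e |: D) :|: (U :\ e).
  by rewrite -setUA setUCA setD1K.
have := card_partitions_no_singleton_rec eDU (negbT (setD11 e U)).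
rewrite setD1K // DU_rem => /(congr1 Posz).
rewrite PoszD (IHn _ _ ltUe disDUe) {1}DU_move (IHn _ _ ltUe dis_eDUe).
move=> /(canLR (addKr _)) <-.
rewrite cardsU1 eD (cardsD1 e U) eU -linearN -linearD /=; congr bell_eval.
by rewrite !exprS; ring.
Qed.

Lemma largest_singletonE N (P : {set {set 'I_N}}) (i : 'I_N) :
  largest_singleton P i =
  ([set i] \in P) && no_singleton_in [set j : 'I_N | (i < j)%N] P.
Proof.
by congr andb; apply: eq_forallb => j; rewrite inE.
Qed.

Lemma A_bell_eval n k : (k <= n)%N ->
  (A n k)%:Z = bell_eval ('X^k * ('X - 1) ^+ (n - k)).
Proof.
move=> lekn; pose e : 'I_n.+1 := Ordinal (lekn : k < n.+1)%N.
pose D := [set j : 'I_n.+1 | (j < k)%N].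
pose U := [set j : 'I_n.+1 | (k < j)%N].
have cD : #|D| = k by apply/card_ord_lt/leqW.
have cU : #|U| = (n - k)%N.
  have -> : U = ~: [set j : 'I_n.+1 | (j < k.+1)%N].
    by apply/setP => j; rewrite !inE -leqNgt.
  by rewrite cardsCs setCK card_ord card_ord_lt // subSS.
have disDU : [disjoint D & U].
  rewrite disjoints_subset; apply/subsetP => j.
  by rewrite !inE -leqNgt => /ltnW.
have DU : [set: 'I_n.+1] :\ e = D :|: U.
  by apply/setP => j; rewrite !inE andbT neq_ltn.
rewrite -cU -[X in 'X^X]cD -card_partitions_no_singleton // -DU; congr Posz.
rewrite -card_partitions_no_singleton_block ?inE ?ltnn //.
apply: eq_card => P; rewrite !inE -andbA; congr andb.
rewrite [RHS]andbC -(largest_singletonE P e).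
apply/existsP/idP => [[i /andP[/eqP ik]]|maxe]; last by exists e; rewrite eqxx.
by have -> : i = e by apply: val_inj.
Qed.

Lemma bell_eval_mul_exprDn (c d : int) (k n : nat) :
  bell_eval (('X + c%:A) ^+ k * ('X + d%:A) ^+ n) =
  \sum_(0 <= i < k.+1) \sum_(0 <= r < n.+1)
    'C(k, i)%:Z * 'C(n, r)%:Z * c ^+ (k - i) * d ^+ (n - r) * (bell (r + i))%:Z.
Proof.
rewrite scalar_mul_exprDn; apply: eq_bigr => i _; apply: eq_bigr => r _.
by rewrite -exprD /= umbral_evalXn addnC !natz.
Qed.

Lemma bell_eval_falling_mul_exp m n k :
  bell_eval (falling m * ('X^k * ('X - 1) ^+ n)) =
  bell_eval (('X + m%:Z%:A) ^+ k * ('X + (m%:Z - 1)%:A) ^+ n).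
Proof.
rewrite bell_eval_falling comp_polyM comp_Xn_poly rmorphXn /= comp_polyB.
by rewrite comp_polyX rmorph1 !alg_polyC -addrA -polyCB.
Qed.

Lemma sum_stirling1_A n m k :
  \sum_(0 <= j < m.+1) stirling1 m j * (A (n + k + j) (k + j))%:Z =
  bell_eval (('X + m%:Z%:A) ^+ k * ('X + (m%:Z - 1)%:A) ^+ n).
Proof.
rewrite -bell_eval_falling_mul_exp -[falling m]comp_polyXr.
rewrite scalar_falling_comp_poly; apply: eq_bigr => j _; congr (_ * _).
by rewrite -addnA A_bell_eval ?leq_addl // addnK exprD mulrCA mulrA.
Qed.

Lemma sum_stirling1_A_addn1 n m k :
  \sum_(0 <= j < m.+1) stirling1 m j * (A (n + k + j + 1) (n + 1))%:Z =
  bell_eval (('X + m%:Z%:A) ^+ k * ('X + (m%:Z + 1)%:A) ^+ n).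
Proof.
transitivity (bell_eval (falling m.+1 * ('X^n * ('X - 1) ^+ k))); last first.
  by rewrite bell_eval_falling_mul_exp intS [1 + _]addrC addrK mulrC.
rewrite fallingS -mulrA mulrCA scalar_falling_comp_poly.
apply: eq_bigr => j _; congr (_ * _).
rewrite A_bell_eval; last by lia.
have -> : (n + k + j + 1 - (n + 1) = k + j)%N by lia.
by congr bell_eval; rewrite !exprD expr1; ring.
Qed.

Theorem theorem3p9 (n m k : nat) :
  [/\ \sum_(0 <= j < m.+1) stirling1 m j * (A (n + k + j) (k + j))%:Z =
      \sum_(0 <= i < k.+1) \sum_(0 <= r < n.+1)
        'C(k, i)%:Z * 'C(n, r)%:Z * m%:Z ^+ (n + k - i - r) * (A (r + i) i)%:Z,
      \sum_(0 <= j < m.+1) stirling1 m j * (A (n + k + j) (k + j))%:Z =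
      \sum_(0 <= i < k.+1) \sum_(0 <= r < n.+1)
        'C(k, i)%:Z * 'C(n, r)%:Z * m%:Z ^+ (k - i) * (m%:Z - 1) ^+ (n - r)
          * (bell (r + i))%:Z
    & \sum_(0 <= j < m.+1) stirling1 m j * (A (n + k + j + 1) (n + 1))%:Z =
      \sum_(0 <= i < k.+1) \sum_(0 <= r < n.+1)
        'C(k, i)%:Z * 'C(n, r)%:Z * m%:Z ^+ (k - i) * (m%:Z + 1) ^+ (n - r)
          * (bell (r + i))%:Z].
Proof.
split; last 2 first.
- by rewrite sum_stirling1_A bell_eval_mul_exprDn.
- by rewrite sum_stirling1_A_addn1 bell_eval_mul_exprDn.
have shiftE : 'X + (m%:Z - 1)%:A = 'X - 1 + m%:Z%:A :> {poly int}.
  by rewrite scalerBl scale1r addrCA addrC.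
rewrite sum_stirling1_A shiftE scalar_mul_exprDn.
apply: eq_big_nat => i /andP[_ leik]; apply: eq_big_nat => r /andP[_ lern].
rewrite A_bell_eval ?leq_addl // addnK !natz -addnBA // -addnBAC // exprD.
by ring.
Qed.
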